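(* Suppose that $G$ satisfies: (i) there is $0<\alpha<1$ such that for $m$-almost every $\underline{x}\in\Sigma_A^+$ one has $d(G(\underline{x},y_1),G(\underline{x},y_2))\le \alpha\, d(y_1,y_2)$ for all $y_1,y_2\in K$; (ii) for every $y\in K$ there is $k_y\ge0$ with $d(G(\underline{x}^1,y),G(\underline{x}^2,y))\le k_y\,d_\theta(\underline{x}^1,\underline{x}^2)$ for all $\underline{x}^1,\underline{x}^2\in\Sigma_A^+$, and $H:=\sup_{y\in K}k_y<\infty$. Then for every positive measure $\mu\in\mathcal{L}_\theta^+$, every representation $\Gamma_\mu^\omega$ of $\mu$ (associated with a disintegration $\omega$ of $\mu$) and all $n\ge1$, $$|\Gamma^\omega_{F^{*n}\mu}|_\theta^\omega\le\theta^n\,|\mu|_\theta^\omega+\frac{C_1}{1-\theta}\|\mu\|_\infty,\qquad C_1=\max\{H\theta+\theta N|g|_\theta,\ 2\}.$$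
   Context: Base. Let $A$ be an aperiodic $N\times N$ matrix with entries in $\{0,1\}$ (some power of $A$ has all entries positive), $\Sigma_A^+=\{\underline{x}=(x_i)_{i\ge 0}: x_i\in\{1,\dots,N\},\ A_{x_ix_{i+1}}=1\ \forall i\}$, with the metric $d_\theta(\underline{x},\underline{y})=\sum_{i\ge0}\theta^i(1-\delta(x_i,y_i))$, where $\theta\in(0,1)$ is fixed and $\delta(a,b)=1$ if $a=b$, $0$ otherwise. Let $\sigma$ be the left shift and $m$ a Markov measure associated to $(\Sigma_A^+,\sigma)$ (the $\sigma$-invariant probability given by a stochastic matrix $(p_{ij})$ with $p_{ij}>0$ iff $A_{ij}=1$ and its stationary probability vector). Let $P_i=\{\underline{x}:x_0=i\}$, $\sigma_i=\sigma|_{P_i}$, $i\underline{x}=\sigma_i^{-1}(\underline{x})$ (the sequence $i,x_0,x_1,\dots$, when $A_{i,x_0}=1$), and let $J_{m,\sigma_i}:P_i\to(0,\infty)$ be the Jacobian of $\sigma_i$: $m(\sigma_i(E))=\int_EJ_{m,\sigma_i}\,dm$ for measurable $E\subset P_i$. Put $g_i=1/J_{m,\sigma_i}$ on $P_i$, let $g:\Sigma_A^+\to\mathbb{R}$ be the function with $g|_{P_i}=g_i$ for all $i$, and let $|g|_\theta$ be its Lipschitz constant with respect to $d_\theta$. Skew product. $(K,d)$ is a compact metric space with $\operatorname{diam}(K)=1$; $\Sigma:=\Sigma_A^+\times K$; $G:\Sigma\to K$ is measurable (Borel) and $F(\underline{x},y)=(\sigma(\underline{x}),G(\underline{x},y))$.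 Put $\gamma_{\underline{x}}=\{\underline{x}\}\times K$, $F_{\gamma_{\underline{x}}}(y)=G(\underline{x},y)$, $\pi_1(\underline{x},y)=\underline{x}$, $\pi_2(\underline{x},y)=y$. For a map $f$, $f^*$ is push-forward of measures; $F^*\mu(E)=\mu(F^{-1}(E))$ and $F^{*n}$ is its $n$-th iterate. Measures. For a finite signed Borel measure $\nu$ on a compact metric space $X$, $\|\nu\|_W=\sup\{|\int h\,d\nu| : h:X\to\mathbb{R}\text{ Lipschitz with constant}\le1,\ \|h\|_\infty\le1\}$. Let $\mathcal{AB}$ be the set of finite signed Borel measures $\mu=\mu^+-\mu^-$ (Jordan decomposition) on $\Sigma$ such that $\pi_1^*\mu^\pm\ll m$; write $\phi_1=\frac{d(\pi_1^*\mu)}{dm}$. For positive $\mu\in\mathcal{AB}$ a disintegration $\omega=(\{\mu_{\gamma_{\underline{x}}}\},\phi_1)$ along the leaves consists of $\phi_1$ and probabilities on $\Sigma$ with $\mu_{\gamma_{\underline{x}}}(\gamma_{\underline{x}})=1$ for $\phi_1m$-a.e. $\underline{x}$, $\underline{x}\mapsto\mu_{\gamma_{\underline{x}}}(E)$ measurable, and $\mu(E)=\int\mu_{\gamma_{\underline{x}}}(E)\phi_1(\underline{x})\,dm(\underline{x})$ for all measurable $E$. The associated restriction is the positive measure on $K$, $\mu|_{\gamma_{\underline{x}}}(B)=\phi_1(\underline{x})\,\mu_{\gamma_{\underline{x}}}(\pi_2^{-1}(B))$ (zero where $\phi_1(\underline{x})=0$), and $\|\mu\|_\infty=\operatorname{ess\,sup}_{\underline{x}}\|\mu|_{\gamma_{\underline{x}}}\|_W$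 with respect to $m$. Paths. For a positive $\mu\in\mathcal{AB}$ with disintegration $\omega$, the representation of $\mu$ is the path $\Gamma_\mu^\omega(\underline{x})=\mu|_{\gamma_{\underline{x}}}$ of positive measures on $K$ (defined $m$-a.e.). For a path $\Gamma$ of measures on $K$ defined $m$-a.e., its Lipschitz constant is $\operatorname{ess\,sup}_{\underline{x}^1\neq\underline{x}^2}\|\Gamma(\underline{x}^1)-\Gamma(\underline{x}^2)\|_W/d_\theta(\underline{x}^1,\underline{x}^2)$, the essential supremum over pairs with respect to $m$ (i.e. $m\times m$). $|\mu|_\theta^\omega$ denotes the Lipschitz constant of $\Gamma_\mu^\omega$, $|\mu|_\theta=\inf_\omega|\mu|_\theta^\omega$, and $\mathcal{L}_\theta^+=\{\mu\in\mathcal{AB}:\mu\ge0,|\mu|_\theta<\infty\}$. Given $\Gamma_\mu^\omega$, the path representing $F^*\mu$ is $$\Gamma^\omega_{F^*\mu}(\underline{x})=\sum_{i:\,A_{i,x_0}=1}g_i(i\underline{x})\,F_{\gamma_{i\underline{x}}}^*\Gamma_\mu^\omega(i\underline{x})\quad\text{for }m\text{-a.e. }\underline{x};$$ $\Gamma^\omega_{F^{*n}\mu}$ is the path representing $F^{*n}\mu$ obtained by applying this formula $n$ times starting from $\Gamma_\mu^\omega$, and $|\Gamma^\omega_{F^{*n}\mu}|_\theta^\omega$ is its Lipschitz constant. *)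

(* Defs.v *)
From HB Require Import structures.
From mathcomp Require Import all_boot all_order all_algebra.
From mathcomp Require Import all_classical all_reals all_analysis.
From mathcomp Require Import measurable_realfun ess_sup_inf.

Set Implicit Arguments.
Unset Strict Implicit.
Unset Printing Implicit Defensive.

Import Order.TTheory GRing.Theory Num.Theory.
Import numFieldNormedType.Exports.

Local Open Scope classical_set_scope.
Local Open Scope ring_scope.

(* Measurable types carry a base point, hence pointed metric spaces; as only
   nonempty spaces occur below, the base point is no restriction. *)
#[short(type="pmetricType")]
HB.structure Definition PMetric (R : numDomainType) :=
  {T of Metric R T & Pointed T}.

Definition borel (R : realType) (T : pmetricType R) : Type :=
  g_sigma_algebraType (@open T).

HB.instance Definition _ (R : realType) (T : pmetricType R) :=
  PMetric.copy (borel T) T.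
HB.instance Definition _ (R : realType) (T : pmetricType R) :=
  Measurable.copy (borel T) (g_sigma_algebraType (@open T)).

Record aperiodic_matrix (N : nat) := AperiodicMatrix {
  adj :> 'M[nat]_N ;
  adj_dim : (0 < N)%N ;
  adj_le1 : forall i j, (adj i j <= 1)%N ;
  adj_aperiodic : exists2 k, (0 < k)%N & forall i j, (0 < (adj ^+ k) i j)%N }.

(* One-sided sequences; [theta] is recorded in the type because it determines
   the metric. *)
Definition shift_space (R : realType) (N : nat) (A : aperiodic_matrix N)
    (theta : {itv R & `]0, 1[}) : Type :=
  {x : nat -> 'I_N | forall k, A (x k) (x k.+1) = 1%N}.

Section shift_space.
Context {R : realType} {N : nat} {A : aperiodic_matrix N}.
Context {theta : {itv R & `]0, 1[}}.
Local Notation X := (shift_space A theta).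
Implicit Types x y z : X.

Definition letter x : nat -> 'I_N := sval x.

HB.instance Definition _ := gen_eqMixin X.
HB.instance Definition _ := gen_choiceMixin X.

Lemma adj_succ (i : 'I_N) : exists j, A i j = 1%N.
Proof.
have [[//|k] _ /(_ i i)] := adj_aperiodic A.
rewrite exprS mxE lt0n sum_nat_eq0 => /forallPn/= [j].
rewrite muln_eq0 negb_or => /andP[Aij _]; exists j.
by apply/eqP; rewrite eqn_leq adj_le1 lt0n.
Qed.

Lemma shift_space_inhabited : exists x : X, True.
Proof.
pose s i := projT1 (cid (@adj_succ i)).
have sP i : A i (s i) = 1%N by rewrite /s; case: cid.
pose w k := iter k s (Ordinal (adj_dim A)).
have wP k : A (w k) (w k.+1) = 1%N by exact: sP.
by exists (exist _ w wP).
Qed.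

HB.instance Definition _ := isPointed.Build X
  (projT1 (cid shift_space_inhabited)).

Definition dist_term x y : R^nat :=
  fun i => theta%:num ^+ i * (letter x i != letter y i)%:R.

Definition dist_theta x y : R := limn (series (dist_term x y)).

Lemma theta_gt0 : 0 < theta%:num :> R.
Proof. by []. Qed.

Lemma theta_lt1 : theta%:num < 1 :> R.
Proof. by []. Qed.

Lemma dist_term_ge0 x y i : 0 <= dist_term x y i.
Proof. by rewrite /dist_term mulr_ge0. Qed.

Lemma cvg_dist_term x y : cvgn (series (dist_term x y)).
Proof.
apply: (@series_le_cvg _ _ (fun i => theta%:num ^+ i)).
- exact: dist_term_ge0.
- by move=> i; rewrite exprn_ge0.
- move=> i; rewrite /dist_term ler_piMr//.
  by case: (_ != _).
- have := @is_cvg_geometric_series R 1 theta%:num.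
  rewrite ger0_norm ?ltW ?theta_gt0// => /(_ theta_lt1).
  rewrite (_ : geometric _ _ = (fun i => theta%:num ^+ i))//.
  by apply/funext => i; rewrite /geometric/= mul1r.
Qed.

Lemma dist_thetaxx x : dist_theta x x = 0.
Proof.
rewrite /dist_theta (_ : dist_term x x = (fun=> 0)).
  rewrite (_ : series _ = (fun=> 0)) ?lim_cst//.
  by apply/funext => n; rewrite /series/= big1.
by apply/funext => i; rewrite /dist_term eqxx mulr0.
Qed.

Lemma dist_theta_sym x y : dist_theta x y = dist_theta y x.
Proof.
by congr (limn (series _)); apply/funext => i; rewrite /dist_term eq_sym.
Qed.

Lemma dist_term_le x y i : dist_term x y i <= dist_theta x y.
Proof.
apply: (@le_trans _ _ (series (dist_term x y) i.+1)).
  rewrite /series/= big_nat_recr//= lerDr.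
  by rewrite sumr_ge0// => k _; exact: dist_term_ge0.
apply: nondecreasing_cvgn_le; last exact: cvg_dist_term.
by apply: nondecreasing_series => k _ _; exact: dist_term_ge0.
Qed.

Lemma dist_theta_positivity x y : dist_theta x y = 0 -> x = y.
Proof.
move=> d0; case: x y d0 => [x xP] [y yP] d0; apply: eq_exist => /=.
apply/funext => i; apply/eqP/negPn/negP => xy.
have := dist_term_le (exist _ x xP) (exist _ y yP) i.
rewrite d0 /dist_term/= xy mulr1 leNgt exprn_gt0//; exact: theta_gt0.
Qed.

Lemma dist_theta_triangle y x z :
  dist_theta x z <= dist_theta x y + dist_theta y z.
Proof.
rewrite /dist_theta -limD; [|exact: cvg_dist_term..].
apply: ler_lim; first exact: cvg_dist_term.
  by apply: is_cvgD; exact: cvg_dist_term.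
apply: nearW => n; rewrite fctE /series/= -big_split/=; apply: ler_sum => i _.
rewrite /dist_term -mulrDr ler_pM2l ?exprn_gt0 ?theta_gt0//.
have [->|] := eqVneq (letter x i) (letter y i); first by rewrite add0r.
by move=> _; rewrite ler_wpDr ?ler0n// ler_nat leq_b1.
Qed.

HB.instance Definition _ := isMetric.Build R X dist_thetaxx
  dist_theta_positivity dist_theta_sym dist_theta_triangle.

Lemma shift_subproof x k : A (letter x k.+1) (letter x k.+2) = 1%N.
Proof. exact: (svalP x k.+1). Qed.

Definition left_shift x : X :=
  exist _ (fun k => letter x k.+1) (shift_subproof x).

Lemma prepend_subproof i x : A i (letter x 0) = 1%N -> forall k,
  A (if k is k'.+1 then letter x k' else i) (letter x k) = 1%N.
Proof. by move=> Aix [//|k]; exact: (svalP x k). Qed.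

(* Only meaningful when [A i (letter x 0) = 1]; otherwise returns [x]. *)
Definition prepend (i : 'I_N) x : X :=
  if pselect (A i (letter x 0) = 1%N) is left Aix then
    exist _ (fun k => if k is k'.+1 then letter x k' else i)
      (prepend_subproof Aix)
  else x.

End shift_space.

Section base.
Context {R : realType} {N : nat} {A : aperiodic_matrix N}.
Context {theta : {itv R & `]0, 1[}}.
Local Notation X := (shift_space A theta).
Variable m : probability (borel X) R.

Definition cylinder (w : nat -> 'I_N) (n : nat) : set (borel X) :=
  [set x : X | forall k, (k <= n)%N -> letter x k = w k].

Record markov_with (p : 'M[R]_N) (q : 'rV[R]_N) : Prop := {
  markov_ge0 : forall i j, 0 <= p i j ;
  markov_sum : forall i, \sum_j p i j = 1 ;
  markov_supp : forall i j, 0 < p i j <-> A i j = 1%N ;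
  stationary_ge0 : forall i, 0 <= q 0 i ;
  stationary_sum : \sum_i q 0 i = 1 ;
  stationary : q *m p = q ;
  markov_cylinder : forall w n,
    m (cylinder w n) = (q 0 (w 0%N) * \prod_(k < n) p (w k) (w k.+1))%:E }.

Definition is_markov_measure : Prop := exists p q, markov_with p q.

Definition branch (i : 'I_N) : set (borel X) := [set x : X | letter x 0 = i].

(* The Jacobians of the restrictions of [left_shift] to each [branch i], glued
   into one function; they are determined m-a.e. only. *)
Record is_jacobian (J : borel X -> R) : Prop := {
  jacobian_measurable : measurable_fun [set: borel X] J ;
  jacobian_gt0 : forall x, 0 < J x ;
  jacobianE : forall i (E : set (borel X)), measurable E -> E `<=` branch i ->
    m ((left_shift : borel X -> borel X) @` E) =
      (\int[m]_(x in E) (J x)%:E)%E }.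

(* The pairs [x = y] contribute [0 / 0 = 0]. *)
Definition lip_const (f : borel X -> R) : \bar R :=
  ereal_sup [set (`|f p.1 - f p.2| / mdist p.1 p.2)%:E | p in [set: X * X]].

End base.

Section charge_sum.
Context d (T : measurableType d) (R : realType) (I : finType) (P : pred I).
Variable nu : I -> {charge set T -> \bar R}.
Local Open Scope ereal_scope.

Definition csum (B : set T) : \bar R := \sum_(i | P i) nu i B.

Lemma csum_charge (s : seq I) :
  exists c : {charge set T -> \bar R}, forall B,
    c B = \sum_(i <- s | P i) nu i B.
Proof.
elim: s => [|i s [c cE]]; first by exists czero => B; rewrite big_nil.
case Pi : (P i); last by exists c => B; rewrite big_cons Pi.
by exists (cadd (nu i) c) => B; rewrite big_cons Pi /= /cadd /= cE.
Qed.

Let csumE : exists c : {charge set T -> \bar R}, csum = c.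
Proof.
have [c cE] := csum_charge (index_enum I).
by exists c; apply/funext => B; rewrite cE.
Qed.

Let csum0 : csum set0 = 0.
Proof. by have [c ->] := csumE; exact: charge0. Qed.

Let csum_finite B : measurable B -> csum B \is a fin_num.
Proof. by have [c ->] := csumE => ?; exact: fin_num_measure. Qed.

Let csum_sigma_additive : semi_sigma_additive csum.
Proof. by have [c ->] := csumE; exact: charge_semi_sigma_additive. Qed.

HB.instance Definition _ := isCharge.Build _ _ _ csum
  csum0 csum_finite csum_sigma_additive.

End charge_sum.

Section charge_image.
Context d1 d2 (T1 : measurableType d1) (T2 : measurableType d2) (R : realType).
Variables (f : {mfun T1 >-> T2}) (nu : {charge set T1 -> \bar R}).
Local Open Scope ereal_scope.

Definition cimage : set T2 -> \bar R := pushforward nu f.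

Let mf : measurable_fun [set: T1] f. Proof. exact: measurable_funPT. Qed.

Let cimage0 : cimage set0 = 0.
Proof. by rewrite /cimage /pushforward preimage_set0 charge0. Qed.

Let cimage_finite B : measurable B -> cimage B \is a fin_num.
Proof.
move=> mB; rewrite /cimage /pushforward; apply: fin_num_measure.
by rewrite -[X in measurable X]setTI; exact: mf.
Qed.

Let cimage_sigma_additive : semi_sigma_additive cimage.
Proof.
move=> F mF tF mUF; rewrite /cimage /pushforward preimage_bigcup.
apply: charge_semi_sigma_additive.
- by move=> n; rewrite -[X in measurable X]setTI; exact: mf.
- apply/trivIsetP => /= i j _ _ ij; rewrite -preimage_setI.
  by move/trivIsetP : tF => /(_ _ _ _ _ ij) ->//; rewrite preimage_set0.
- by rewrite -preimage_bigcup -[X in measurable X]setTI; exact: mf.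
Qed.

HB.instance Definition _ := isCharge.Build _ _ _ cimage
  cimage0 cimage_finite cimage_sigma_additive.

End charge_image.

HB.instance Definition _ d1 d2 (T1 : measurableType d1)
    (T2 : measurableType d2) :=
  isMeasurableFun.Build _ _ _ _ (@snd T1 T2) measurable_snd.

Section Wnorm.
Context (R : realType) (T : pmetricType R).
Implicit Type nu : {charge set (borel T) -> \bar R}.
Local Open Scope ereal_scope.

Lemma hahn_exists nu :
  exists PN : set (borel T) * set (borel T), hahn_decomposition nu PN.1 PN.2.
Proof. by have [P [N PN]] := Hahn_decomposition nu; exists (P, N). Qed.

(* The Jordan decomposition does not depend on the Hahn decomposition chosen. *)
Definition charge_integral nu (h : borel T -> R) : \bar R :=
  let PN := projT2 (cid (hahn_exists nu)) in
  \int[jordan_pos PN]_y (h y)%:E - \int[jordan_neg PN]_y (h y)%:E.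

Definition Wnorm nu : \bar R :=
  ereal_sup [set `|charge_integral nu h| | h in [set h : borel T -> R |
    (forall y1 y2, (`|h y1 - h y2| <= mdist y1 y2)%R) /\
    (forall y, (`|h y| <= 1)%R)]].

End Wnorm.

Section paths.
Context {R : realType} {N : nat} {A : aperiodic_matrix N}.
Context {theta : {itv R & `]0, 1[}} {K : pmetricType R}.
Local Notation X := (borel (shift_space A theta)).
Local Notation Y := (borel K).
Variable m : probability X R.
Local Open Scope ereal_scope.

(* Paths are total functions, of which only the m-a.e. class matters. *)
Definition leaf_path := X -> {charge set Y -> \bar R}.

(* The pairs [x1 = x2] contribute [0 / 0 = 0]. *)
Definition path_lip (Gamma : leaf_path) : \bar R :=
  ess_sup (m \x m) (fun p : X * X =>
    Wnorm (cadd (Gamma p.1) (copp (Gamma p.2))) * ((mdist p.1 p.2)^-1)%:E).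

Definition path_norm (Gamma : leaf_path) : \bar R :=
  ess_sup m (fun x => Wnorm (Gamma x)).

(* All metric spaces involved are separable, so the Borel sets of a product are
   its product sigma-algebra. *)
Section disintegration.
Variable mu : {finite_measure set (X * Y)%type -> \bar R}.

Record disintegration := Disintegration {
  density : X -> R ;
  leaf : X -> probability (X * Y)%type R ;
  density_measurable : measurable_fun [set: X] density ;
  densityE : forall B : set X, measurable B ->
    pushforward mu fst B = \int[m]_(x in B) (density x)%:E ;
  leaf_measurable : forall E : set (X * Y)%type, measurable E ->
    measurable_fun [set: X] (fun x : X => leaf x E : \bar R) ;
  leaf_fiber : {ae m, forall x : X, density x != 0%R ->
    leaf x [set z | z.1 = x] = 1} ;
  leafE : forall E : set (X * Y)%type, measurable E ->
    mu E = \int[m]_x (leaf x E * (density x)%:E) }.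

Definition representation (omega : disintegration) : leaf_path := fun x =>
  cscale (density omega x)
    (cimage (@snd X Y)
      (charge_of_finite_measure (leaf omega x))).

Definition theta_seminorm : \bar R :=
  ereal_inf [set path_lip (representation omega) |
    omega in [set: disintegration]].

(* A finite signed measure that is positive is a finite measure, with zero
   negative part. *)
Definition in_L_theta_plus : Prop :=
  pushforward mu fst `<< m /\ theta_seminorm < +oo.

End disintegration.

Variable G : {mfun (X * Y)%type >-> Y}.

Definition fiber_map (x : X) : Y -> Y := fun y => G (x, y).

Lemma fiber_map_measurable x : measurable_fun [set: Y] (fiber_map x).
Proof.
by apply: measurableT_comp => //; exact: pair2_measurable.
Qed.

HB.instance Definition _ x := isMeasurableFun.Build _ _ _ _ (fiber_map x)
  (fiber_map_measurable x).

Definition transfer (g : X -> R) (Gamma : leaf_path) : leaf_path := fun x =>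
  let x0 := letter (x : shift_space A theta) 0 in
  csum (fun i => A i x0 == 1%N)
    (fun i => let ix : X := prepend i x in
      cscale (g ix) (cimage (fiber_map ix) (Gamma ix))).

End paths.

(* Main.v *)
From HB Require Import structures.
Require Import Defs.
From mathcomp Require Import all_boot all_order all_algebra.
From mathcomp Require Import all_classical all_reals all_analysis.
From mathcomp Require Import measurable_realfun ess_sup_inf.
From mathcomp Require Import ring lra.
Set Implicit Arguments.
Unset Strict Implicit.
Unset Printing Implicit Defensive.

Import Order.TTheory GRing.Theory Num.Theory.
Import numFieldNormedType.Exports.

Local Open Scope classical_set_scope.
Local Open Scope ring_scope.

(** The estimate is a Lasota-Yorke inequality, obtained by iterating the
    one-step bounds
      [|T Gamma| <= theta |Gamma| + C1 ||Gamma||],  [||T Gamma|| <= ||Gamma||]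
    for the transfer operator on paths
      [T Gamma (x) = \sum_i g(ix) (F_ix # Gamma(ix))],
    where [#] is push-forward and [F_ix] the fibre map over [ix].

    Everything is tested against a function [h : K -> R] that is 1-Lipschitz and
    bounded by 1, the integral of [h] being additive in the charge.  Let [x] and
    [y] start with the same letter, so that they have the same inverse branches
    and [d(ix, iy) = theta d(x, y)].  Branch by branch,
    [T Gamma (x) - T Gamma (y)] is the sum of
    - [g(ix) (F_ix # (Gamma(ix) - Gamma(iy)))]: since [F_ix] contracts the
      fibre, [h \o F_ix] is again a test function, and since the [g(ix)] sum
      to 1 the total is at most [theta |Gamma| d(x, y)];
    - [g(ix) (F_ix # Gamma(iy) - F_iy # Gamma(iy))]: the functions [h \o F_ix]
      and [h \o F_iy] differ by at most [H theta d(x, y)], and are integrated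
      against a mass at most [||Gamma||];
    - [(g(ix) - g(iy)) (F_iy # Gamma(iy))]: this is at most
      [|g| theta d(x, y) ||Gamma||] for each of the at most [N] branches.
    If [x] and [y] start with different letters then [d(x, y) >= 1], and the
    trivial bound [2 ||Gamma||] suffices ([transfer_diff], [transfer_bound]).
    Summing the geometric series gives the theorem ([iter_transfer_bound]).

    Two facts on the base hold almost everywhere only.  First, the inverse
    branches are nonsingular for [m] and, on pairs, for [m \x m]; this is what
    lets almost sure properties of [Gamma] be used at [ix] and [iy]
    ([ae_prepend], [ae_prepend_pair]).  Secondly [\sum_i g(ix) = 1], which
    expresses the invariance of [m] under the shift
    ([ae_sum_inverse_jacobian]).  As to the positivity of the measures, it turns
    the norm of [Gamma(x)] into its mass, which is additive, so that the norm of
    the path does not increase under [T]. *)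

(** * Integration against charges *)

Section bounded_integrals.
Context d (T : measurableType d) (R : realType).
Implicit Types (mu : {measure set T -> \bar R}) (h : T -> R).

Lemma integrable_bounded mu h c : (mu setT < +oo)%E ->
  measurable_fun setT h -> (forall y, `|h y| <= c) ->
  mu.-integrable setT (EFin \o h).
Proof.
move=> mufin mh hc; apply: measurable_bounded_integrable => //.
by exists c; split=> [|M cM y _]; [exact: num_real|exact: le_trans (hc y) (ltW cM)].
Qed.

Lemma le_norm_Rintegral mu h c : (mu setT < +oo)%E ->
  measurable_fun setT h -> (forall y, `|h y| <= c) ->
  `|\int[mu]_y h y| <= c * fine (mu setT).
Proof.
move=> mufin mh hc; have ih := integrable_bounded mufin mh hc.
apply: le_trans (le_normr_Rintegral measurableT ih) _.
rewrite -Rintegral_cst//; apply: le_Rintegral => //.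
- exact: integrable_norm ih.
- by apply: (@integrable_bounded _ _ `|c|) => // y; exact: lexx.
Qed.

End bounded_integrals.

Lemma fin_num_sub_add (R : realType) (a b c e : \bar R) :
  a \is a fin_num -> b \is a fin_num -> c \is a fin_num -> e \is a fin_num ->
  (a - b = c - e)%E -> (c + b = e + a)%E.
Proof.
move: a b c e => [a| |] [b| |] [c| |] [e| |]//= _ _ _ _ [] abce.
by rewrite -!EFinD; congr (_%:E); lra.
Qed.

Section charge_integral.
Context (R : realType) (T : pmetricType R).
Local Notation Y := (borel T).
Implicit Types (nu : {charge set Y -> \bar R}) (h : Y -> R).
Implicit Types mu : {measure set Y -> \bar R}.

Definition cint nu h : R := fine (charge_integral nu h).

Definition bounded_test h :=
  measurable_fun [set: Y] h /\ exists c, forall y, `|h y| <= c.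

Lemma bounded_test_integrable mu h : (mu setT < +oo)%E -> bounded_test h ->
  mu.-integrable setT (EFin \o h).
Proof. by move=> mufin [mh [c hc]]; exact: integrable_bounded hc. Qed.

(** Any way of writing a charge as a difference of finite measures computes its
    integral: if [pos - neg = mu1 - mu2] then [pos + mu2 = neg + mu1] as
    measures.  All linearity statements below follow from this freedom. *)
Lemma charge_integralE nu mu1 mu2 h : bounded_test h ->
  (mu1 setT < +oo)%E -> (mu2 setT < +oo)%E ->
  (forall B, measurable B -> nu B = mu1 B - mu2 B)%E ->
  charge_integral nu h = (\int[mu1]_y h y - \int[mu2]_y h y)%:E.
Proof.
move=> bh fin1 fin2 nuE; rewrite /charge_integral; set PN := projT2 _.
have jp : (jordan_pos PN setT < +oo)%E by rewrite ltey_eq fin_num_measure.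
have jn : (jordan_neg PN setT < +oo)%E by rewrite ltey_eq fin_num_measure.
have i1 := bounded_test_integrable fin1 bh.
have i2 := bounded_test_integrable fin2 bh.
have ip := bounded_test_integrable jp bh.
have jn' := bounded_test_integrable jn bh.
have mh : measurable_fun setT (EFin \o h) by exact: measurable_int i1.
have fin_le mu B : (mu setT < +oo)%E -> measurable B -> mu B \is a fin_num.
  move=> muT mB; rewrite ge0_fin_numE//; apply: le_lt_trans muT.
  by apply: le_measure; rewrite ?inE.
have E : (\int[measure_add (jordan_pos PN) mu2]_y (h y)%:E =
          \int[measure_add (jordan_neg PN) mu1]_y (h y)%:E)%E.
  apply: eq_measure_integral => B mB _; rewrite [LHS]measure_addE [RHS]measure_addE.
  apply: fin_num_sub_add; [exact: fin_le..|].
  by rewrite -nuE// (jordan_decomp PN mB) /cadd/= cscaleN1.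
rewrite !integral_measure_add// in E.
move: (E); rewrite -(fineK (integrable_fin_num measurableT i1)).
rewrite -(fineK (integrable_fin_num measurableT i2)).
rewrite -(fineK (integrable_fin_num measurableT ip)).
rewrite -(fineK (integrable_fin_num measurableT jn')).
rewrite -!EFinD /Rintegral => -[e]; congr (_%:E); rewrite /= in e *; lra.
Qed.

Lemma cintE nu mu1 mu2 h : bounded_test h ->
  (mu1 setT < +oo)%E -> (mu2 setT < +oo)%E ->
  (forall B, measurable B -> nu B = mu1 B - mu2 B)%E ->
  cint nu h = \int[mu1]_y h y - \int[mu2]_y h y.
Proof. by move=> bh f1 f2 e; rewrite /cint (charge_integralE bh f1 f2 e). Qed.

Lemma charge_jordan nu : exists mu1 mu2 : {finite_measure set Y -> \bar R},
  forall B, measurable B -> (nu B = mu1 B - mu2 B)%E.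
Proof.
have [P [N PN]] := Hahn_decomposition nu.
exists (jordan_pos PN), (jordan_neg PN) => B mB.
by rewrite (jordan_decomp PN mB) /cadd/= cscaleN1.
Qed.

Lemma finite_measure_lty (mu : {finite_measure set Y -> \bar R}) :
  (mu setT < +oo)%E.
Proof. by rewrite ltey_eq fin_num_measure. Qed.

Lemma charge_integral_cint nu h : bounded_test h ->
  charge_integral nu h = (cint nu h)%:E.
Proof.
move=> bh; have [mu1 [mu2 nuE]] := charge_jordan nu.
rewrite /cint (charge_integralE bh _ _ nuE)//; exact: finite_measure_lty.
Qed.

End charge_integral.

Lemma Rintegral_mscale d (T : measurableType d) (R : realType)
    (mu : {measure set T -> \bar R}) (k : {nonneg R}) (h : T -> R) :
  mu.-integrable setT (EFin \o h) ->
  \int[mscale k mu]_y h y = k%:num * \int[mu]_y h y.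
Proof.
move=> ih; have mh : measurable_fun setT (EFin \o h) by exact: measurable_int ih.
rewrite -RintegralZl// /Rintegral; congr fine.
rewrite [LHS]integralE ge0_integral_mscale//; last exact: measurable_funepos.
rewrite ge0_integral_mscale//; last exact: measurable_funeneg.
under [RHS]eq_integral do rewrite EFinM.
rewrite integralZl// [X in _ = (_ * X)%E]integralE [RHS]muleBr//.
rewrite fin_num_adde_defl// fin_numN.
by rewrite (integrable_fin_num _ (integrable_funeneg _ ih)).
Qed.

Section charge_integral_linear.
Context (R : realType) (T : pmetricType R).
Local Notation Y := (borel T).
Implicit Types (nu : {charge set Y -> \bar R}) (h : Y -> R).
Local Notation test := (@bounded_test R T).

Lemma eq_cint nu nu' h : test h -> (forall B, measurable B -> nu B = nu' B) ->
  cint nu h = cint nu' h.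
Proof.
move=> th e; have [mu1 [mu2 nuE]] := charge_jordan nu'.
rewrite !(cintE th (finite_measure_lty mu1) (finite_measure_lty mu2))// => B mB.
by rewrite e// nuE.
Qed.

Lemma cint0 nu h : test h -> (forall B, measurable B -> nu B = 0%E) ->
  cint nu h = 0.
Proof.
move=> th e; have [mu1 [mu2 _]] := charge_jordan nu.
rewrite (cintE th (finite_measure_lty mu1) (finite_measure_lty mu1)) ?subrr//.
move=> B mB.
by rewrite e// subee// fin_num_measure.
Qed.

Lemma cint_add nu1 nu2 h : test h ->
  cint (cadd nu1 nu2) h = cint nu1 h + cint nu2 h.
Proof.
move=> th.
have [a [b abE]] := charge_jordan nu1; have [c [e ceE]] := charge_jordan nu2.
have fin (u v : {finite_measure set Y -> \bar R}) : (measure_add u v setT < +oo)%E.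
  rewrite measure_addE lte_add_pinfty//; exact: finite_measure_lty.
rewrite (cintE th (finite_measure_lty a) (finite_measure_lty b) abE).
rewrite (cintE th (finite_measure_lty c) (finite_measure_lty e) ceE).
rewrite (cintE th (fin a c) (fin b e)); last first.
  move=> B mB; rewrite [X in (X - _)%E]measure_addE [X in (_ - X)%E]measure_addE.
  rewrite [LHS]/= /cadd abE// ceE// fin_num_oppeD ?fin_num_measure//.
  by rewrite addeACA.
have ii (u : {finite_measure set Y -> \bar R}) :
    u.-integrable setT (EFin \o h).
  by apply: bounded_test_integrable => //; exact: finite_measure_lty.
have add (u v : {finite_measure set Y -> \bar R}) :
    \int[measure_add u v]_y h y = \int[u]_y h y + \int[v]_y h y.
  rewrite /Rintegral (integral_measure_add measurableT (ii u) (ii v)).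
  by rewrite fineD// integrable_fin_num//; exact: ii.
by rewrite !add; lra.
Qed.

Lemma cint_opp nu h : test h -> cint (copp nu) h = - cint nu h.
Proof.
move=> th; have [a [b abE]] := charge_jordan nu.
rewrite (cintE th (finite_measure_lty a) (finite_measure_lty b) abE).
rewrite (cintE th (finite_measure_lty b) (finite_measure_lty a)) ?opprB//.
move=> B mB; rewrite [LHS]/= /copp abE// fin_num_oppeB ?fin_num_measure//.
by rewrite addeC.
Qed.

Lemma cint_sub nu1 nu2 h : test h ->
  cint (cadd nu1 (copp nu2)) h = cint nu1 h - cint nu2 h.
Proof. by move=> th; rewrite cint_add// cint_opp. Qed.

Lemma cint_scale nu c h : 0 <= c -> test h ->
  cint (cscale c nu) h = c * cint nu h.
Proof.
move=> c0 th; have [a [b abE]] := charge_jordan nu.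
have fin (u : {finite_measure set Y -> \bar R}) :
    (mscale (NngNum c0) u setT < +oo)%E.
  rewrite /mscale/= ltey_eq fin_numM//=; exact: fin_num_measure.
rewrite (cintE th (finite_measure_lty a) (finite_measure_lty b) abE).
rewrite (cintE th (fin a) (fin b)); last first.
  move=> B mB; rewrite [LHS]/= /cscale abE// muleBr//.
  by rewrite fin_num_adde_defl// fin_numN fin_num_measure.
have ii (u : {finite_measure set Y -> \bar R}) :
    u.-integrable setT (EFin \o h).
  by apply: bounded_test_integrable => //; exact: finite_measure_lty.
by rewrite !Rintegral_mscale//= mulrBr.
Qed.

Lemma cint_csum (I : finType) (P : pred I) (nu : I -> {charge set Y -> \bar R})
    h : test h -> cint (csum P nu) h = \sum_(i | P i) cint (nu i) h.
Proof.
move=> th; rewrite /csum.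
suff H (s : seq I) nu' : (forall B, measurable B ->
    nu' B = \sum_(i <- s | P i) nu i B)%E ->
    cint nu' h = \sum_(i <- s | P i) cint (nu i) h by exact: H.
elim: s nu' => [|i s IH] nu' e.
  by rewrite big_nil; apply: cint0 => // B mB; rewrite e// big_nil.
have [c cE] := csum_charge P nu s.
rewrite big_cons; case: ifPn => Pi; last first.
  by apply: IH => B mB; rewrite e// big_cons (negbTE Pi).
rewrite -(IH c)// -cint_add//; apply: eq_cint => // B mB.
by rewrite e// big_cons Pi [RHS]/= /cadd cE.
Qed.

Lemma bounded_test_comp (f : {mfun Y >-> Y}) h : test h -> test (h \o f).
Proof.
move=> [mh [c hc]]; split; first exact: measurableT_comp.
by exists c => y; exact: hc.
Qed.

Lemma cint_image (f : {mfun Y >-> Y}) nu h : test h ->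
  cint (cimage f nu) h = cint nu (h \o f).
Proof.
move=> th; have thf := bounded_test_comp f th.
have [a [b abE]] := charge_jordan nu.
have fin (u : {finite_measure set Y -> \bar R}) :
    (pushforward u f setT < +oo)%E.
  by rewrite /pushforward preimage_setT; exact: finite_measure_lty.
rewrite (cintE thf (finite_measure_lty a) (finite_measure_lty b) abE).
rewrite (cintE th (fin a) (fin b)); last first.
  move=> B mB; rewrite [LHS]/= /cimage /pushforward abE//.
  by rewrite -[X in measurable X]setTI; exact: measurable_funPT.
have ii (u : {finite_measure set Y -> \bar R}) :
    u.-integrable setT (EFin \o (h \o f)).
  by apply: bounded_test_integrable => //; exact: finite_measure_lty.
have push (u : {finite_measure set Y -> \bar R}) :
    \int[pushforward u f]_y h y = \int[u]_y (h \o f) y.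
  have [mh _] := th; rewrite /Rintegral integral_pushforward//.
    exact/measurable_EFinP.
  by rewrite preimage_setT; exact: ii.
by rewrite !push.
Qed.

(** The bound is asked of all sets, measurable or not, because this is the form
    in which a charge can be turned back into a measure. *)
Definition nonneg_charge nu := forall B, (0 <= nu B)%E.

Lemma cint_nonneg nu (nu0 : nonneg_charge nu) h : test h ->
  cint nu h = \int[measure_of_charge nu nu0]_y h y.
Proof.
move=> th; rewrite (cintE (mu1 := measure_of_charge nu nu0) (mu2 := mzero) th).
- rewrite [X in _ - X](_ : _ = 0) ?subr0//.
  by rewrite /Rintegral integral_measure_zero.
- by rewrite ltey_eq; apply/orP; left; exact: fin_num_measure.
- by rewrite [ltLHS]/= /mzero ltry.
- by move=> B mB; rewrite [X in (_ - X)%E]/= /mzero sube0.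
Qed.

Lemma le_norm_cint nu h c : nonneg_charge nu -> measurable_fun setT h ->
  (forall y, `|h y| <= c) -> `|cint nu h| <= c * fine (nu setT).
Proof.
move=> nu0 mh hc; rewrite (cint_nonneg nu0); last by split => //; exists c.
apply: le_norm_Rintegral => //.
by rewrite ltey_eq; apply/orP; left; exact: fin_num_measure.
Qed.

Lemma cintB nu h1 h2 : nonneg_charge nu -> test h1 -> test h2 ->
  cint nu (h1 \- h2) = cint nu h1 - cint nu h2.
Proof.
move=> nu0 t1 t2.
have fin : (measure_of_charge nu nu0 setT < +oo)%E.
  by rewrite ltey_eq; apply/orP; left; exact: fin_num_measure.
have t12 : test (h1 \- h2).
  have [m1 [c1 b1]] := t1; have [m2 [c2 b2]] := t2.
  split; first exact: measurable_funB.
  by exists (c1 + c2) => y; rewrite /= (le_trans (ler_normB _ _))// lerD.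
by rewrite !(cint_nonneg nu0)// RintegralB//; exact: bounded_test_integrable.
Qed.

Lemma cint_cst nu c : nonneg_charge nu -> cint nu (cst c) = c * fine (nu setT).
Proof.
move=> nu0; rewrite (cint_nonneg nu0); last by split=> //; exists `|c|.
exact: Rintegral_cst.
Qed.

End charge_integral_linear.

(** * The dual Lipschitz norm *)

Section Wnorm_theory.
Context (R : realType) (T : pmetricType R).
Local Notation Y := (borel T).
Implicit Types (nu : {charge set Y -> \bar R}) (h : Y -> R).

Definition test_fun h :=
  (forall y1 y2, `|h y1 - h y2| <= mdist y1 y2) /\ (forall y, `|h y| <= 1).

Lemma lipschitz_measurable h : (forall y1 y2, `|h y1 - h y2| <= mdist y1 y2) ->
  measurable_fun setT h.
Proof.
move=> lip; apply: (measurability _ (RGenOInfty.measurableE R)) => B [_ [x ->] <-].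
rewrite setTI; apply: sub_sigma_algebra.
suff : open (h @^-1` `]x, +oo[ : set T) by [].
rewrite openE => y /=.
rewrite in_itv/= andbT => xh; apply/nbhs_ballP.
exists (h y - x); first by rewrite /= subr_gt0.
move=> z; rewrite ballEmdist/= in_itv/= andbT => yz.
have := le_lt_trans (lip y z) yz; rewrite ltr_norml => /andP[_]; lra.
Qed.

Lemma test_fun_bounded h : test_fun h -> bounded_test h.
Proof.
by move=> [lip h1]; split; [exact: lipschitz_measurable|exists 1].
Qed.

Lemma cint_le_Wnorm nu h : test_fun h -> (`|cint nu h|%:E <= Wnorm nu)%E.
Proof.
move=> th; apply: ereal_sup_ubound; exists h => //.
by rewrite charge_integral_cint//; exact: test_fun_bounded.
Qed.

Lemma Wnorm_le nu (c : \bar R) :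
  (forall h, test_fun h -> `|cint nu h|%:E <= c)%E -> (Wnorm nu <= c)%E.
Proof.
move=> H; apply: ge_ereal_sup => _ [h th <-].
rewrite charge_integral_cint; first exact: H.
exact: test_fun_bounded.
Qed.

Lemma Wnorm_ge0 nu : (0 <= Wnorm nu)%E.
Proof.
apply: le_trans (cint_le_Wnorm nu (h := cst 0) _); first by rewrite lee_fin.
by split=> [y1 y2|y]; rewrite /= ?subrr normr0// mdist_ge0.
Qed.

(** The constant function 1 is a test function. *)
Lemma mass_le_Wnorm nu : nonneg_charge nu -> (nu setT <= Wnorm nu)%E.
Proof.
move=> nu0; apply: le_trans (cint_le_Wnorm nu (h := cst 1) _); last first.
  by split=> [y1 y2|y]; rewrite /= ?subrr ?normr0 ?normr1// mdist_ge0.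
rewrite cint_cst// mul1r ger0_norm ?fine_ge0// fineK//.
exact: fin_num_measure.
Qed.

End Wnorm_theory.

(** * The shift space *)

Section shift_geometry.
Context {R : realType} {N : nat} {A : aperiodic_matrix N}.
Context {theta : {itv R & `]0, 1[}}.
Local Notation X := (shift_space A theta).
Local Notation th := (theta%:num : R).
Implicit Types x y z : X.

Lemma shift_ext x y : letter x =1 letter y -> x = y.
Proof.
by case: x y => [x xP] [y yP] /= e; apply: eq_exist; apply/funext => k; exact: e.
Qed.

Definition admissible (i : 'I_N) x := A i (letter x 0) = 1%N.

Lemma letter_prepend0 i x : admissible i x -> letter (prepend i x) 0 = i.
Proof. by rewrite /prepend => Aix; case: pselect. Qed.

Lemma letter_prependS i x k : admissible i x ->
  letter (prepend i x) k.+1 = letter x k.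
Proof. by rewrite /prepend => Aix; case: pselect. Qed.

Lemma prepend_inadmissible i x : ~ admissible i x -> prepend i x = x.
Proof. by rewrite /prepend => Aix; case: pselect. Qed.

Lemma left_shiftK i x : admissible i x -> left_shift (prepend i x) = x.
Proof. by move=> Aix; apply: shift_ext => k; exact: letter_prependS. Qed.

Lemma admissible_shift x : admissible (letter x 0) (left_shift x).
Proof. exact: (svalP x 0%N). Qed.

Lemma prependK x : prepend (letter x 0) (left_shift x) = x.
Proof.
have Ax := admissible_shift x; apply: shift_ext => -[|k].
  by rewrite letter_prepend0.
by rewrite letter_prependS.
Qed.

Lemma dist_thetaS x y : dist_theta x y =
  (letter x 0 != letter y 0)%:R + th * dist_theta (left_shift x) (left_shift y).
Proof.
apply/cvg_lim => //; rewrite -cvg_shiftS.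
rewrite [X in X @ _ --> _](_ : _ = fun n => (letter x 0 != letter y 0)%:R +
    th * series (dist_term (left_shift x) (left_shift y)) n).
  by apply: cvgD; [exact: cvg_cst|apply: cvgZr; exact: cvg_dist_term].
apply/funext => n; rewrite /series/= big_nat_recl//.
rewrite {1}/dist_term expr0 mul1r mulr_sumr; congr (_ + _).
by apply: eq_bigr => k _; rewrite /dist_term exprS mulrA.
Qed.

Lemma mdist_thetaE x y : mdist x y = dist_theta x y.
Proof. by []. Qed.

(** This is where the contraction rate of the final estimate comes from. *)
Lemma mdist_prepend i x y : admissible i x -> admissible i y ->
  mdist (prepend i x) (prepend i y) = th * mdist x y.
Proof.
move=> Ax Ay; rewrite !mdist_thetaE dist_thetaS !left_shiftK//.
by rewrite !letter_prepend0// eqxx add0r.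
Qed.

Lemma mdist_letter_neq x y k : letter x k != letter y k ->
  th ^+ k <= mdist x y.
Proof.
by move=> xy; have := dist_term_le x y k; rewrite /dist_term xy mulr1.
Qed.

Lemma mdist_ge1 x y : letter x 0 != letter y 0 -> 1 <= mdist x y.
Proof. exact: (@mdist_letter_neq x y 0%N). Qed.

Lemma theta_ge0 : 0 <= th. Proof. exact: ltW (theta_gt0 (theta := theta)). Qed.

Lemma onem_theta_gt0 : 0 < 1 - th.
Proof. by rewrite subr_gt0; exact: theta_lt1. Qed.

Lemma mdist_le x y : mdist x y <= (1 - th)^-1.
Proof.
apply: limr_le; first exact: cvg_dist_term.
apply: nearW => n; rewrite -[leRHS]mul1r ler_pdivlMr ?onem_theta_gt0//.
apply: (@le_trans _ _ (1 - th ^+ n)); last by rewrite gerBl exprn_ge0// theta_ge0.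
rewrite /series/=; elim: n => [|n IH].
  by rewrite big_nil mul0r expr0 subrr.
rewrite big_nat_recr//= mulrDl.
have : dist_term x y n <= th ^+ n.
  rewrite /dist_term ler_piMr ?exprn_ge0 ?theta_ge0//.
  by case: (_ != _).
move=> /(ler_wpM2r (ltW onem_theta_gt0)) h.
apply: le_trans (lerD IH h) _; rewrite exprSr; lra.
Qed.

Lemma mdist_agree n x y : (forall k, (k < n)%N -> letter x k = letter y k) ->
  mdist x y <= th ^+ n * (1 - th)^-1.
Proof.
elim: n x y => [|n IH] x y e; first by rewrite mul1r; exact: mdist_le.
rewrite mdist_thetaE dist_thetaS e// eqxx add0r exprS -mulrA.
rewrite ler_wpM2l ?theta_ge0//; apply: IH => k kn; exact: (e k.+1).
Qed.

End shift_geometry.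

Section shift_measurability.
Context {R : realType} {N : nat} {A : aperiodic_matrix N}.
Context {theta : {itv R & `]0, 1[}}.
Local Notation X := (shift_space A theta).
Local Notation BX := (borel X).
Local Notation th := (theta%:num : R).

Lemma open_measurable_borel (U : set X) : open U -> measurable (U : set BX).
Proof. by move=> oU; exact: sub_sigma_algebra. Qed.

Definition coord (k : nat) (a : 'I_N) : set BX :=
  [set x : X | letter x k = a].

Lemma measurable_coord k a : measurable (coord k a).
Proof.
apply: open_measurable_borel; rewrite openE => x /= xa.
apply/nbhs_ballP; exists (th ^+ k); first by rewrite /= exprn_gt0//; exact: theta_gt0.
move=> y; rewrite ballEmdist /coord/= => xy; apply/eqP; rewrite -xa eq_sym.
apply/negPn/negP => /mdist_letter_neq; rewrite leNgt xy//.
Qed.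

Lemma cylinder_bigcap (w : nat -> 'I_N) n :
  cylinder w n = \bigcap_(k in `I_n.+1) coord k (w k) :> set BX.
Proof. by apply/seteqP; split => x /= xw k; exact: xw. Qed.

Lemma measurable_cylinder (w : nat -> 'I_N) n :
  measurable (cylinder w n : set BX).
Proof.
rewrite cylinder_bigcap; apply: bigcap_measurableType => k _.
exact: measurable_coord.
Qed.

Lemma cylinder_letter (w : nat -> 'I_N) n (x : X) :
  (cylinder w n : set BX) x -> cylinder w n = cylinder (letter x) n :> set BX.
Proof.
move=> xw; apply/seteqP; split => y yw k kn; rewrite yw// ?xw//.
Qed.

Definition cylinders : set (set BX) :=
  [set B | B = set0 \/ exists w n, B = cylinder w n].

Lemma cylinders_setI : setI_closed cylinders.
Proof.
move=> B C [->|[w [n ->]]]; first by rewrite set0I; left.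
move=> [->|[v [p ->]]]; first by rewrite setI0; left.
have [->|/set0P[x [xw xv]]] := eqVneq (cylinder w n `&` cylinder v p : set BX) set0.
  by left.
right; exists (letter (x : X)), (maxn n p).
rewrite (cylinder_letter xw) (cylinder_letter xv).
apply/seteqP; split => [y [yn yp] k|y yx].
  by rewrite leq_max => /orP[|]; [exact: yn|exact: yp].
by split=> k kn; apply: yx; rewrite leq_max kn// orbT.
Qed.

Lemma cylinder_in_open (U : set X) (x : X) : open U -> U x ->
  exists n, (cylinder (letter x) n : set BX) `<=` U.
Proof.
rewrite openE => oU /oU /nbhs_ballP[e /= e0 xeU].
have h : th ^+ n * (1 - th)^-1 @[n --> \oo] --> 0 * (1 - th)^-1.
  apply: cvgMl; apply: cvg_expr.
  by rewrite ger0_norm ?theta_ge0//; exact: theta_lt1.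
rewrite mul0r in h.
move: h => /cvgr0_norm_lt /(_ _ e0) /filter_ex[n /(le_lt_trans (ler_norm _)) ne].
exists n => y yx; apply: xeU; rewrite ballEmdist /=.
apply: le_lt_trans ne; apply: mdist_agree => k /ltnW kn.
by rewrite yx.
Qed.

(** Every open set is the union of the countably many cylinders it contains,
    because the cylinders around a point form a basis of neighbourhoods. *)
Lemma measurable_cylindersE : @measurable _ BX = <<s cylinders >>.
Proof.
apply/seteqP; split; last first.
  apply: smallest_sub; first exact: sigma_algebra_measurable.
  by move=> _ [->|[w [n ->]]]; [exact: measurable0|exact: measurable_cylinder].
apply: smallest_sub; first exact: smallest_sigma_algebra.
move=> U oU.
(* A finite function on n+1 letters codes a cylinder of depth n. *)
pose I := {n : nat & {ffun 'I_n.+1 -> 'I_N}}.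
pose c (p : I) : set BX := cylinder (fun k => tagged p (inord k)) (tag p).
have -> : U = \bigcup_p (if pselect (c p `<=` U) then c p else set0).
  apply/seteqP; split => [x Ux|x [p _]]; last first.
    by case: pselect => [cU /= /cU|cU].

  have [n xnU] := cylinder_in_open oU Ux.
  pose p : I := Tagged (fun n => {ffun 'I_n.+1 -> 'I_N})
    [ffun k : 'I_n.+1 => letter (x : X) k].
  have xp : c p x by move=> k kn; rewrite /= ffunE inordK.
  exists p => //; case: pselect => //; case.
  by rewrite /c (cylinder_letter xp).
apply: (@countable_bigcupT_measurable _ (g_sigma_algebraType cylinders)) => [|p].
  exact: countableP.
case: pselect => [cU|ncU] /=; last exact: measurable0.
by apply: sub_sigma_algebra; right; do 2 eexists; reflexivity.
Qed.

Lemma measurable_fun_coord d (T : measurableType d) (f : T -> BX) :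
  (forall k a, measurable (f @^-1` coord k a)) -> measurable_fun setT f.
Proof.
move=> fka; apply: (measurability _ measurable_cylindersE).
move=> _ [B [->|[w [n ->]]] <-]; rewrite setTI ?preimage_set0//.
rewrite cylinder_bigcap preimage_bigcap.
by apply: bigcap_measurableType => k _; exact: fka.
Qed.

Lemma measurable_left_shift : measurable_fun setT (left_shift : BX -> BX).
Proof. by apply: measurable_fun_coord => k a; exact: (measurable_coord k.+1). Qed.

Lemma measurable_admissible i : measurable ([set x : X | admissible i x] : set BX).
Proof.
rewrite (_ : mkset _ = \bigcup_(a in [set a | A i a = 1%N]) coord 0 a).
  by apply: fin_bigcup_measurable => // a _; exact: measurable_coord.
apply/seteqP; split => [x Aix|x [a /= Aia]]; last first.
  by rewrite /coord/= /admissible => ->.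
by exists (letter (x : X) 0%N).
Qed.

(** Outside of the admissible points [prepend i] is the identity, hence the
    decomposition of the preimages along the admissible set. *)
Lemma measurable_prepend i : measurable_fun setT (prepend i : BX -> BX).
Proof.
apply: measurable_fun_coord => k a.
pose D : set BX := [set x : X | admissible i x].
have mD : measurable D by exact: measurable_admissible.
rewrite (_ : _ @^-1` _ = (D `&` (if k is k'.+1 then coord k' a
    else [set _ | i = a])) `|` (~` D `&` coord k a)); last first.
  apply/seteqP; split => x.
    have [Dx|Dx] := pselect (D x); rewrite /coord/=.
      case: k => [|k]; [rewrite letter_prepend0//|rewrite letter_prependS//];
      by move=> xa; left.
    by rewrite prepend_inadmissible// => xa; right.
  case=> -[Dx]; rewrite /coord/=; last by rewrite prepend_inadmissible.
  by case: k => [|k]; [rewrite letter_prepend0|rewrite letter_prependS].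
apply: measurableU; apply: measurableI => //.
- case: k => [|k]; last exact: measurable_coord.
  have [ia|ia] := pselect (i = a).
    by rewrite (_ : mkset _ = setT)//; apply/seteqP; split.
  by rewrite (_ : mkset _ = set0)//; apply/seteqP; split.
- exact: measurableC.
- exact: measurable_coord.
Qed.

End shift_measurability.

(** * Markov measures and their inverse branches *)

Section markov.
Context {R : realType} {N : nat} {A : aperiodic_matrix N}.
Context {theta : {itv R & `]0, 1[}}.
Local Notation X := (shift_space A theta).
Local Notation BX := (borel X).
Variable m : probability BX R.

Lemma borel_measure_unique (m1 m2 : {measure set BX -> \bar R}) :
  (m1 setT < +oo)%E -> m1 setT = m2 setT ->
  (forall w n, m1 (cylinder w n) = m2 (cylinder w n)) ->
  forall E : set BX, measurable E -> m1 E = m2 E.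
Proof.
move=> m1fin mT mcyl.
pose G : set (set BX) := [set B | cylinders B \/ B = setT].
apply: (measure_unique G (fun _ => setT)) => //.
- apply/seteqP; split.
    rewrite measurable_cylindersE; apply: smallest_sub.
      exact: smallest_sigma_algebra.
    by move=> B cB; apply: sub_sigma_algebra; left.
  apply: smallest_sub; first exact: sigma_algebra_measurable.
  move=> B [cB|-> //]; rewrite measurable_cylindersE.
  exact: sub_sigma_algebra.
- move=> B C [cB|->] [cC|->]; rewrite ?setIT ?setTI; [|by left|by left|by right].
  by left; exact: cylinders_setI.
- by move=> _; right.
- by rewrite bigcup_const//; exists 0%N.
- by move=> B [[->|[w [n ->]]]|->]; rewrite ?measure0.
Qed.

Lemma left_shift_cylinder (w : nat -> 'I_N) n :
  (left_shift : BX -> BX) @^-1` cylinder w n =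
  \big[setU/set0]_(i < N) cylinder (fun k => if k is k'.+1 then w k' else i) n.+1.
Proof.
rewrite (eq_bigl (mem 'I_N))// -bigcup_pred; apply/seteqP; split => [x xw|x [i _ xi] k kn].
  exists (letter (x : X) 0%N) => // -[|k] kn //; exact: xw.
exact: (xi k.+1).
Qed.

Hypothesis hm : is_markov_measure m.

(** On cylinders this is the stationarity of the vector [q], as the preimage of a
    cylinder is the disjoint union of its one-letter extensions. *)
Lemma shift_invariant (E : set BX) : measurable E ->
  m ((left_shift : BX -> BX) @^-1` E) = m E.
Proof.
have msig := @measurable_left_shift R N A theta.
move: E; apply: (borel_measure_unique (m1 := pushforward m (left_shift : BX -> BX))).
- by rewrite [ltLHS]/= /pushforward preimage_setT probability_setT ltry.
- by rewrite [LHS]/= /pushforward preimage_setT.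
move=> w n; have [p [q mpq]] := hm.
rewrite [LHS]/= /pushforward left_shift_cylinder measure_bigsetU_ord_cond; first last.
- apply/trivIsetP => i j _ _ ij; apply/seteqP; split => // x [xi xj].
  by move: ij; rewrite -(xi 0%N)// (xj 0%N)// eqxx.
- by move=> i _; exact: measurable_cylinder.
apply: etrans (esym (markov_cylinder mpq w n)).
apply: etrans (eq_bigr _ (fun i _ => markov_cylinder mpq _ _)) _.
rewrite sumEFin; congr (_%:E).
have -> : q 0 (w 0%N) = \sum_i q 0 i * p i (w 0%N).
  by rewrite -[in LHS](stationary mpq) mxE.
rewrite mulr_suml; apply: eq_bigr => i _.
by rewrite big_ord_recl mulrA.
Qed.

Variable J : BX -> R.
Hypothesis hJ : is_jacobian m J.
Local Notation D i := ([set x : X | admissible i x] : set BX).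
Local Notation prep i := (prepend i : BX -> BX).

Lemma measurable_branch i : measurable (branch i : set BX).
Proof. exact: measurable_coord. Qed.

Lemma measurable_prepend_preimage i (E : set BX) : measurable E ->
  measurable (prep i @^-1` E).
Proof.
by move=> mE; rewrite -[X in measurable X]setTI; exact: measurable_prepend.
Qed.

Lemma left_shift_image i (E : set BX) : E `<=` branch i ->
  (left_shift : BX -> BX) @` E = prep i @^-1` E `&` D i.
Proof.
move=> Ei; apply/seteqP; split => [_ [x Ex <-]|x [Ex Dx]].
  have xi : letter (x : X) 0%N = i by exact: Ei.
  split; first by rewrite /= -xi prependK.
  by rewrite /= -xi; exact: admissible_shift.
by exists (prepend i x) => //; exact: left_shiftK.
Qed.

Lemma prepend_mass i (E : set BX) : measurable E -> E `<=` branch i ->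
  m (prep i @^-1` E `&` D i) = (\int[m]_(x in E) (J x)%:E)%E.
Proof. by move=> mE Ei; rewrite -left_shift_image// (jacobianE hJ mE Ei). Qed.

Lemma prepend_preimage_branch i (E : set BX) :
  prep i @^-1` (E `&` branch i) `&` D i = prep i @^-1` E `&` D i.
Proof.
apply/seteqP; split => x [] /=; first by move=> [Ex _] Dx.
by move=> Ex Dx; split => //; split => //; exact: letter_prepend0.
Qed.

(** The image of [m] under an inverse branch has density [J] with respect to [m],
    so it does not charge null sets. *)
Lemma prepend_null i (E : set BX) : measurable E -> m E = 0%E ->
  m (prep i @^-1` E `&` D i) = 0%E.
Proof.
move=> mE E0; have mEi : measurable (E `&` branch i).
  by apply: measurableI => //; exact: measurable_branch.
rewrite -prepend_preimage_branch prepend_mass//.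
apply: null_set_integral => //.
  apply: measurable_funTS; apply/measurable_EFinP; exact: jacobian_measurable hJ.
by apply: subset_measure0 E0.
Qed.

Lemma ae_prepend (P : BX -> Prop) : {ae m, forall x, P x} ->
  {ae m, forall x, forall i, admissible i (x : X) -> P (prepend i x)}.
Proof.
move=> [E [mE E0 PE]]; apply: filter_forall => i.
exists (prep i @^-1` E `&` D i); split; last first.
- by move=> x /= /not_implyP[Dx nP]; split => //; exact: PE.
- exact: prepend_null.
- apply: measurableI; last exact: measurable_admissible.
  exact: measurable_prepend_preimage.
Qed.

(** The image under [prepend i] of the restriction of [m] to the points where it
    is admissible. *)
Definition branch_image i : set BX -> \bar R :=
  fun E => m (prep i @^-1` E `&` D i).

Section branch_image_measure.
Variable i : 'I_N.

Let image0 : branch_image i set0 = 0%E.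
Proof. by rewrite /branch_image preimage_set0 set0I measure0. Qed.

Let image_ge0 E : (0 <= branch_image i E)%E.
Proof. exact: measure_ge0. Qed.

Let image_sigma_additive : semi_sigma_additive (branch_image i).
Proof.
have mp := @measurable_prepend R N A theta i.
exact: (@measure_semi_sigma_additive _ _ _
  (pushforward (mrestr m (measurable_admissible i)) (prep i))).
Qed.

HB.instance Definition _ := isMeasure.Build _ _ _ (branch_image i)
  image0 image_ge0 image_sigma_additive.

Let image_finite : fin_num_fun (branch_image i).
Proof.
move=> E mE; apply: fin_num_measure; apply: measurableI.
  exact: measurable_prepend_preimage.
exact: measurable_admissible.
Qed.

HB.instance Definition _ := Measure_isFinite.Build _ _ _
  (branch_image i) image_finite.

End branch_image_measure.

Lemma branch_image_dominated i : branch_image i `<< m.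
Proof.
apply/null_content_dominatesP => E mE E0; exact: prepend_null.
Qed.

Lemma integral_branch_image i (E : set BX) (f : BX -> \bar R) :
  measurable E -> measurable_fun setT f -> (forall x, 0 <= f x)%E ->
  (\int[branch_image i]_(x in E) f x =
   \int[m]_(x in prep i @^-1` E `&` D i) f (prepend i x))%E.
Proof.
move=> mE mf f0; have mp := @measurable_prepend R N A theta i.
have mpE := measurable_prepend_preimage i mE.
have mD := @measurable_admissible R N A theta i.
transitivity (\int[pushforward (mrestr m mD) (prep i)]_(x in E) f x)%E.
  by apply: eq_measure_integral.
rewrite ge0_integral_pushforward//; last exact: measurable_funTS.
rewrite (@ge0_negligible_integral _ _ _ _ _ (~` D i))//; first last.
- by rewrite /= /mrestr setICl measure0.
- by move=> x _; exact: f0.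
- by apply: measurable_funTS; exact: measurableT_comp.
- exact: measurableC.
rewrite setDE setCK; apply: eq_measure_integral => B mB BE.
by rewrite /= /mrestr; congr (m _); apply/setIidPl => x /BE[].
Qed.

Lemma jacobian_Radon_Nikodym i :
  ae_eq m (branch i) (Radon_Nikodym_SigmaFinite.f (branch_image i) m)
    (EFin \o J).
Proof.
have dom := branch_image_dominated i; apply: integral_ae_eq.
- exact: measurable_branch.
- apply: (integrableS measurableT) => //; first exact: measurable_branch.
  exact: Radon_Nikodym_SigmaFinite.f_integrable.
- apply: measurable_funTS; apply/measurable_EFinP; exact: jacobian_measurable hJ.
- move=> E Ei mE; rewrite -Radon_Nikodym_SigmaFinite.f_integral//.
  exact: prepend_mass.
Qed.

Lemma measurable_inverse_jacobian :
  measurable_fun setT (fun x => ((J x)^-1)%:E).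
Proof.
apply/measurable_EFinP.
rewrite (_ : (fun x => _) = (fun x => J x `^ (-1))).
  exact: measurableT_comp (measurable_powR _) (jacobian_measurable hJ).
by apply/funext => x; rewrite powR_inv1// ltW// (jacobian_gt0 hJ).
Qed.

(** The density of the image of [m] under [prepend i] is [J], which cancels
    [1 / J]. *)
Lemma integral_inverse_jacobian i (E : set BX) : measurable E ->
  E `<=` branch i ->
  (\int[m]_(x in prep i @^-1` E `&` D i) ((J (prepend i x))^-1)%:E = m E)%E.
Proof.
move=> mE Ei.
have mJV := measurable_inverse_jacobian.
have JV0 x : (0 <= ((J x)^-1)%:E)%E.
  by rewrite lee_fin invr_ge0 ltW// (jacobian_gt0 hJ).
rewrite -(integral_branch_image i mE mJV JV0).
rewrite -(Radon_Nikodym_SigmaFinite.change_of_variables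
  (branch_image_dominated i))//; last exact: measurable_funTS.
transitivity (\int[m]_(x in E) (cst 1%E x))%E; last by rewrite integral_cst// mul1e.
apply: ae_eq_integral => //.
- apply: emeasurable_funM; apply: measurable_funTS => //.
  apply: measurable_int (Radon_Nikodym_SigmaFinite.f_integrable _).
  exact: branch_image_dominated.
- have := ae_eq_subset Ei (jacobian_Radon_Nikodym i); apply: filterS.
  move=> x /= H Ex; rewrite H//= -EFinM mulVf// gt_eqF//.
  exact: (jacobian_gt0 hJ).
Qed.

Lemma sum_measure_branch (E : set BX) : measurable E ->
  (\sum_i m (E `&` branch i) = m E)%E.
Proof.
move=> mE; have mB i := measurable_branch i.
rewrite -(@measure_bigsetU_ord_cond _ _ _ m _ xpredT).
- congr (m _); rewrite (eq_bigl (mem 'I_N))// -bigcup_pred.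
  apply/seteqP; split => [x [i _ []]//|x Ex].
  by exists (letter (x : X) 0%N).
- by move=> i _; exact: measurableI.
- apply/trivIsetP => i j _ _ ij; apply/seteqP; split => // x [[_ xi] [_ xj]].
  by move: ij; rewrite -(xi : letter _ _ = _) (xj : letter _ _ = _) eqxx.
Qed.

(** Both sides have the same integral over every measurable [E]: by
    [integral_inverse_jacobian] the [i]-th summand contributes the measure of
    the part of the shift preimage of [E] lying in the [i]-th branch, and these
    add up to [m E] by invariance. *)
Lemma ae_sum_inverse_jacobian : {ae m, forall x,
  \sum_(i | A i (letter (x : X) 0%N) == 1%N) (J (prepend i x))^-1 = 1}.
Proof.
(* The i-th summand, extended by zero to the points where it is absent. *)
pose t i (x : BX) : \bar R :=
  ((fun x => ((J (prepend i x))^-1)%:E) \_ (D i)) x.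
have JV0 x : (0 <= ((J x)^-1)%:E)%E.
  by rewrite lee_fin invr_ge0 ltW// (jacobian_gt0 hJ).
have t0 i x : (0 <= t i x)%E by rewrite /t patchE; case: ifP.
have mt i : measurable_fun setT (t i).
  apply/(measurable_restrictT _ _).1; first exact: measurable_admissible.
  apply: measurable_funTS.
  exact: measurableT_comp measurable_inverse_jacobian (measurable_prepend i).
have sumE x : (\sum_i t i x)%E =
    (\sum_(i | A i (letter (x : X) 0%N) == 1%N) (J (prepend i x))^-1)%:E.
  rewrite -sumEFin [RHS]big_mkcond; apply: eq_bigr => i _; rewrite /t patchE.
  case: ifPn => [|Dx]; first by rewrite inE /= => ->.
  by case: eqP => // Dx'; move: Dx; rewrite notin_setE.
have : ae_eq m setT (cst 1%E) (fun x => \sum_i t i x)%E.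
  apply: integral_ae_eq => //.
  - apply/integrableP; split => //.
    under eq_integral do rewrite /= normr1.
    by rewrite integral_cst// mul1e [ltLHS]probability_setT ltry.
  - exact: emeasurable_sum.
  - move=> E _ mE; rewrite integral_cst// mul1e.
    rewrite ge0_integral_sum//; last by move=> i; exact: measurable_funTS.
    rewrite -[LHS]shift_invariant//.
    have mS : measurable ((left_shift : BX -> BX) @^-1` E).
      by rewrite -[X in measurable X]setTI; exact: measurable_left_shift.
    rewrite -sum_measure_branch//; apply: eq_bigr => i _.
    rewrite -integral_mkcondr -(integral_inverse_jacobian (i := i))//; last first.
      by apply: measurableI => //; exact: measurable_branch.
    rewrite prepend_preimage_branch; congr (integral _ _ _).
    apply/seteqP; split => x [/= Ex Dx]; split => //.
      by move: Ex; rewrite left_shiftK.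
    by rewrite left_shiftK.
apply: filterS => x /(_ Logic.I); rewrite sumE => -[].
by move=> <-.
Qed.

Local Open Scope ereal_scope.

Lemma ae_pair (P : BX -> Prop) : {ae m, forall x, P x} ->
  {ae m \x m, forall p, P p.1 /\ P p.2}.
Proof.
move=> [E [mE E0 PE]]; exists (E `*` setT `|` setT `*` E); split.
- by apply: measurableU; exact: measurableX.
- apply: null_set_setU; [exact: measurableX|exact: measurableX|..].
    by apply: etrans (product_measure1E m m mE measurableT) _;
    apply: etrans (congr1 (fun u => u * _) E0) (mul0e _).
  by apply: etrans (product_measure1E m m measurableT mE) _;
    apply: etrans (congr1 (fun u => _ * u) E0) (mule0 _).
- move=> p /= /not_andP[nP|nP]; [left|right]; split => //; exact: PE.
Qed.

Lemma null_product_sectionsP (E : set (BX * BX)) : measurable E ->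
  (m \x m) E = 0 <-> {ae m, forall x, m (xsection E x) = 0}.
Proof.
move=> mE; have := ae_eq_integral_abs m measurableT
  (measurable_fun_xsection m mE).
have -> : \int[m]_x `|(m \o xsection E) x| = (m \x m) E.
  by apply: eq_integral => x _; rewrite gee0_abs.
move=> ->; split; first by apply: filterS => x /(_ Logic.I).
by apply: filterS => x xE _.
Qed.

(** By Fubini a set of pairs is null exactly when almost all its sections are, so
    nonsingularity in one variable is applied twice: to the set of bad first
    coordinates, then to the remaining null sections. *)
Lemma ae_prepend_pair (P : BX * BX -> Prop) : {ae m \x m, forall p, P p} ->
  {ae m \x m, forall p, forall i, admissible i (p.1 : X) ->
    admissible i (p.2 : X) -> P (prepend i p.1, prepend i p.2)}.
Proof.
move=> [E [mE E0 PE]]; apply: filter_forall => i.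
have mD := @measurable_admissible R N A theta i.
pose f (p : BX * BX) : BX * BX := (prepend i p.1, prepend i p.2).
have mf : measurable_fun setT f.
  apply/measurable_fun_pairP; split.
    exact: measurableT_comp (measurable_prepend i) measurable_fst.
  exact: measurableT_comp (measurable_prepend i) measurable_snd.
have mG : measurable (f @^-1` E `&` (D i `*` D i)).
  apply: measurableI; last exact: measurableX.
  by rewrite -[X in measurable X]setTI; exact: mf.
exists (f @^-1` E `&` (D i `*` D i)); split => //; last first.
  move=> p /= /not_implyP[D1 /not_implyP[D2 nP]]; split => //; exact: PE.
apply/null_product_sectionsP => //.
have /ae_prepend := (null_product_sectionsP mE).1 E0.
apply: (@filterS _ _ (ae_filter_ringOfSetsType m)) => x /(_ i) H.
have [Dx|Dx] := pselect (admissible i (x : X)); last first.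
  rewrite (_ : xsection _ _ = set0) ?measure0//; apply/seteqP; split => // y.
  by rewrite /xsection/= inE => -[_ []].
rewrite -[RHS](prepend_null i _ (H Dx)); last exact: measurable_xsection.
congr (m _); apply/seteqP; split => y; rewrite /xsection/= ?inE.
  by move=> [Ey [_ Dy]]; split => //; rewrite inE.
by move=> [Ey Dy].
Qed.

End markov.

(** * The one-step inequality *)

Section transfer_operator.
Context {R : realType} {N : nat} {A : aperiodic_matrix N}.
Context {theta : {itv R & `]0, 1[}} {K : pmetricType R}.
Local Notation S := (shift_space A theta).
Local Notation X := (borel S).
Local Notation Y := (borel K).
Local Notation th := (theta%:num : R).
Variable m : probability X R.
Variable G : {mfun (X * Y)%type >-> Y}.
Implicit Types (Gamma : X -> {charge set Y -> \bar R}) (g : X -> R).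

Lemma cint_transfer g Gamma (x : X) (h : Y -> R) : (forall x, 0 <= g x) ->
  bounded_test h ->
  cint (transfer G g Gamma x) h =
  \sum_(i | A i (letter (x : S) 0) == 1%N)
    g (prepend i x) * cint (Gamma (prepend i x)) (h \o fiber_map G (prepend i x)).
Proof.
move=> g0 bh; rewrite cint_csum//; apply: eq_bigr => i _.
by rewrite cint_scale// cint_image.
Qed.

Lemma transfer_nonneg g Gamma (x : X) : (forall x, 0 <= g x) ->
  (forall i, admissible i (x : S) -> nonneg_charge (Gamma (prepend i x))) ->
  nonneg_charge (transfer G g Gamma x).
Proof.
move=> g0 Gam0 B; apply: sume_ge0 => i /eqP Aix.
by apply: mule_ge0; [rewrite lee_fin|exact: Gam0].
Qed.

Lemma test_fun_comp (h : Y -> R) (x : X) :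
  (forall y1 y2, mdist (G (x, y1)) (G (x, y2)) <= mdist y1 y2) ->
  test_fun h -> test_fun (h \o fiber_map G x).
Proof.
move=> Gx [hl h1]; split => [y1 y2|y] /=; last exact: h1.
exact: le_trans (hl _ _) (Gx _ _).
Qed.

(** Bounds [L] and [M] on the Lipschitz constant and on the norm of a path of
    positive charges.  Testing against one [h] at a time avoids dividing by the
    distance, and the mass, unlike the norm, is additive. *)
Record path_bound Gamma (L M : R) : Prop := {
  path_bound_mass : {ae m, forall x : X,
    nonneg_charge (Gamma x) /\ fine (Gamma x setT) <= M} ;
  path_bound_lip : {ae (m \x m)%E, forall p : X * X,
    forall h, test_fun h ->
    `|cint (Gamma p.1) h - cint (Gamma p.2) h| <= L * mdist p.1 p.2} }.

Lemma le_norm_cint_mass (nu : {charge set Y -> \bar R}) (h : Y -> R) (c M : R) :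
  nonneg_charge nu -> fine (nu setT) <= M -> 0 <= c -> measurable_fun setT h ->
  (forall y, `|h y| <= c) -> `|cint nu h| <= c * M.
Proof.
move=> nu0 nuM c0 mh hc; apply: le_trans (le_norm_cint nu0 mh hc) _.
by rewrite ler_wpM2l.
Qed.

Section lasota_yorke.
Hypothesis hm : is_markov_measure m.
Variable J : X -> R.
Hypothesis hJ : is_jacobian m J.
Local Notation g := (fun x => (J x)^-1).
Hypothesis contraction : {ae m, forall x : X, forall y1 y2 : Y,
  mdist (G (x, y1)) (G (x, y2)) <= mdist y1 y2}.
Variable H : R.
Hypothesis H0 : 0 <= H.
Hypothesis fiber_lip : forall (y : Y) (x1 x2 : X),
  mdist (G (x1, y)) (G (x2, y)) <= H * mdist x1 x2.

Let g0 x : 0 <= g x.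
Proof. by rewrite invr_ge0 ltW// (jacobian_gt0 hJ). Qed.

(** The weights of the branches sum to 1 almost everywhere, so the total mass at
    [x] is an average of masses at preimages of [x]. *)
Lemma transfer_mass Gamma L M : path_bound Gamma L M ->
  {ae m, forall x : X, nonneg_charge (transfer G g Gamma x) /\
    fine (transfer G g Gamma x setT) <= M}.
Proof.
move=> [/(ae_prepend hJ) mass _].
have := ae_sum_inverse_jacobian hm hJ.
move: mass; apply: (@filterS2 _ _ (ae_filter_ringOfSetsType m)) => x mass sum1.
have tr0 : nonneg_charge (transfer G g Gamma x).
  by apply: transfer_nonneg => // i /mass[].
split => //.
have b1 : bounded_test (cst 1 : Y -> R).
  by split => //; exists 1 => y; rewrite /= normr1.
rewrite -[leLHS]mul1r -cint_cst// cint_transfer//.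
rewrite -[leRHS]mul1r -[X in _ <= X * _]sum1 mulr_suml; apply: ler_sum => i /eqP /mass[nn le_M].
by rewrite ler_wpM2l//; apply: le_trans le_M; rewrite [leLHS](cint_cst 1 nn) mul1r.
Qed.

(** The three-term splitting for points with the same first letter.  The
    Lipschitz condition on [g] is multiplied by [M], so that it is void for a
    path of mass zero even when [g] is not Lipschitz. *)
Lemma transfer_diff Gamma (L M D : R) (x y : X) h :
  0 <= L -> 0 <= M -> 0 <= D ->
  (forall x y, `|g x - g y| * M <= D * mdist x y) ->
  \sum_(i | A i (letter (x : S) 0) == 1%N) g (prepend i x) = 1 ->
  letter (x : S) 0 = letter (y : S) 0 ->
  (forall i, admissible i (x : S) -> forall y1 y2,
    mdist (G (prepend i x, y1)) (G (prepend i x, y2)) <= mdist y1 y2) ->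
  (forall i, admissible i (y : S) ->
    nonneg_charge (Gamma (prepend i y)) /\
    fine (Gamma (prepend i y) setT) <= M) ->
  (forall i, admissible i (x : S) -> admissible i (y : S) ->
    forall h, test_fun h ->
    `|cint (Gamma (prepend i x)) h - cint (Gamma (prepend i y)) h| <=
      L * mdist (prepend i x : X) (prepend i y)) ->
  test_fun h ->
  `|cint (transfer G g Gamma x) h - cint (transfer G g Gamma y) h| <=
  (th * L + (H * th * M + th * N%:R * D)) * mdist x y.
Proof.
move=> L0 M0 D0 glip sum1 xy contr mass lip tf; set d := mdist x y.
have d0 : 0 <= d by exact: mdist_ge0.
have t0 := @theta_ge0 R theta.
have bh := test_fun_bounded tf.
rewrite !cint_transfer// -xy -sumrB.
apply: (@le_trans _ _ (\sum_(i | A i (letter (x : S) 0) == 1%N)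
   (g (prepend i x) * ((th * L + H * th * M) * d) + D * (th * d)))).
  apply: le_trans (ler_norm_sum _ _ _) _; apply: ler_sum => i /eqP Ax.
  have Ay : admissible i (y : S) by rewrite /admissible -xy.
  have dix : mdist (prepend i x : X) (prepend i y) = th * d.
    exact: mdist_prepend.
  set u := prepend i x; set v := prepend i y.
  have [nv Mv] := mass _ Ay.
  have tu : test_fun (h \o fiber_map G u).
    by apply: test_fun_comp => //; exact: contr.
  have bu := test_fun_bounded tu.
  have bv := bounded_test_comp (fiber_map G v) bh.
  have e1 : `|cint (Gamma u) (h \o fiber_map G u) -
      cint (Gamma v) (h \o fiber_map G u)| <= L * (th * d).
    by rewrite -dix; exact: lip.
  have e2 : `|cint (Gamma v) (h \o fiber_map G u) -
      cint (Gamma v) (h \o fiber_map G v)| <= H * (th * d) * M.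
    rewrite -cintB//; apply: le_norm_cint_mass => //.
    - by rewrite !mulr_ge0.
    - by apply: measurable_funB; [case: bu|case: bv].
    - move=> z /=; apply: le_trans (tf.1 _ _) _.
      by rewrite -dix; exact: fiber_lip.
  have e3 : `|cint (Gamma v) (h \o fiber_map G v)| <= M.
    rewrite -[leRHS]mul1r; apply: le_norm_cint_mass => //; first by case: bv.
    by move=> z; exact: tf.2.
  have e4 := glip u v; rewrite dix in e4.
  move: e1 e2 e3; set a := cint _ _; set b := cint _ _; set c := cint _ _.
  move=> e1 e2 e3.
  rewrite (_ : _ - _ = g u * (a - b) + g u * (b - c) + (g u - g v) * c); last ring.
  apply: le_trans (ler_normD _ _) _; apply: lerD.
    apply: le_trans (ler_normD _ _) _; rewrite !normrM !(ger0_norm (g0 u)).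
    rewrite -mulrDr ler_wpM2l//; apply: le_trans (lerD e1 e2) _.
    by rewrite le_eqVlt; apply/orP; left; apply/eqP; ring.
  rewrite normrM; apply: le_trans e4.
  by rewrite ler_wpM2l.
rewrite big_split/= -mulr_suml sum1 mul1r sumr_const.
have : D * (th * d) *+ #|[pred i | A i (letter (x : S) 0) == 1%N]| <=
    N%:R * (D * (th * d)).
  rewrite -[leLHS]mulr_natl ler_wpM2r ?mulr_ge0// ler_nat.
  by rewrite -[leqRHS]card_ord max_card.
by move=> /(lerD (lexx ((th * L + H * th * M) * d))) /le_trans; apply; lra.
Qed.

(** When the first letters differ, the distance is at least 1 and each of the two
    values is bounded by [M]. *)
Lemma transfer_bound Gamma (L M D C : R) : 0 <= L -> 0 <= M -> 0 <= D ->
  (forall x y, `|g x - g y| * M <= D * mdist x y) ->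
  2 * M <= C -> H * th * M + th * N%:R * D <= C ->
  path_bound Gamma L M -> path_bound (transfer G g Gamma) (th * L + C) M.
Proof.
move=> L0 M0 D0 glip MC HC pb; have tmass := transfer_mass pb.
split => //; case: pb => mass lip.
have sum1 := ae_sum_inverse_jacobian hm hJ.
have FF : Filter (nbhs (almost_everywhere (m \x m)%E)).
  exact: ae_filter_ringOfSetsType.
have aemass := ae_pair (ae_prepend hJ mass).
have aecontr := ae_pair (ae_prepend hJ contraction).
have aetot := @filterI _ _ FF _ _ (ae_pair sum1) (ae_pair tmass).
have aelip := ae_prepend_pair hJ lip.
have := @filterI _ _ FF _ _ aelip (@filterI _ _ FF _ _ aemass (@filterI _ _ FF _ _ aecontr aetot)).
have t0 := @theta_ge0 R theta.
apply: (@filterS _ _ FF) => -[x y] /= [lip'] [[_ massy]] [[contrx _]] [[sumx _]] [mx my].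
move=> h tf; have d0 : 0 <= mdist x y by exact: mdist_ge0.
have C0 : 0 <= C by apply: le_trans MC; rewrite mulr_ge0.
have [xy|xy] := eqVneq (letter (x : S) 0%N) (letter (y : S) 0%N).
  apply: le_trans (transfer_diff L0 M0 D0 glip sumx xy contrx massy _ tf) _.
    by move=> i Ax Ay; exact: lip'.
  by rewrite ler_wpM2r// lerD2l.
have bound z : nonneg_charge (transfer G g Gamma z) /\
    fine (transfer G g Gamma z setT) <= M ->
    `|cint (transfer G g Gamma z) h| <= M.
  move=> [nz zM]; rewrite -[leRHS]mul1r; apply: le_norm_cint_mass => //.
    by case: (test_fun_bounded tf).
  by case: tf.
apply: le_trans (ler_normB _ _) _.
apply: le_trans (lerD (bound _ mx) (bound _ my)) _.
have C_le : C <= th * L + C by rewrite lerDr mulr_ge0.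
apply: (@le_trans _ _ C); first by apply: le_trans MC; lra.
apply: (le_trans C_le); rewrite -[leLHS]mulr1 ler_wpM2l//.
  by rewrite addr_ge0// mulr_ge0.
exact: mdist_ge1.
Qed.

(** The second coefficient is the partial geometric sum [C \sum_(k < n) theta^k],
    the solution of the recursion given by [transfer_bound]. *)
Lemma iter_transfer_bound Gamma (L M D C : R) n : 0 <= L -> 0 <= M -> 0 <= D ->
  (forall x y, `|g x - g y| * M <= D * mdist x y) ->
  2 * M <= C -> H * th * M + th * N%:R * D <= C ->
  path_bound Gamma L M ->
  path_bound (iter n (transfer G g) Gamma)
    (th ^+ n * L + C * ((1 - th ^+ n) / (1 - th))) M.
Proof.
move=> L0 M0 D0 glip MC HC pb; have t0 := @theta_ge0 R theta.
have C0 : 0 <= C by apply: le_trans MC; rewrite mulr_ge0.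
have t1 : 1 - th != 0 by rewrite gt_eqF// onem_theta_gt0.
elim: n => [|n IH]; first by rewrite expr0 subrr mul0r mulr0 addr0 mul1r.
rewrite iterS [X in path_bound _ X _](_ : _ =
    th * (th ^+ n * L + C * ((1 - th ^+ n) / (1 - th))) + C).
  apply: transfer_bound D0 glip MC HC IH => //.
  apply: addr_ge0; first by rewrite mulr_ge0// exprn_ge0.
  exact: mulr_ge0.
by rewrite exprS; field.
Qed.

End lasota_yorke.
End transfer_operator.

(** * Representations of measures, and the theorem *)

Section path_constants.
Context {R : realType} {N : nat} {A : aperiodic_matrix N}.
Context {theta : {itv R & `]0, 1[}} {K : pmetricType R}.
Local Notation S := (shift_space A theta).
Local Notation X := (borel S).
Local Notation Y := (borel K).
Variable m : probability X R.
Implicit Types Gamma : X -> {charge set Y -> \bar R}.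

Lemma path_lip_ge0 Gamma : (0 <= path_lip m Gamma)%E.
Proof.
apply: ess_sup_gee.
  rewrite -setXTT; apply: (@lt_le_trans _ _ (m setT * m setT)%E).
    by rewrite [X in (X * _)%E]probability_setT mul1e [ltRHS]probability_setT.
  by rewrite [leRHS]product_measure1E.
apply: aeW => p; apply: mule_ge0; first exact: Wnorm_ge0.
by rewrite lee_fin invr_ge0 mdist_ge0.
Qed.

Lemma path_norm_ge0 Gamma : (0 <= path_norm m Gamma)%E.
Proof.
apply: ess_sup_gee; first by rewrite [ltRHS]probability_setT.
by apply: aeW => x; exact: Wnorm_ge0.
Qed.

Lemma path_bound_of_norms Gamma (L M : R) :
  {ae m, forall x : X, nonneg_charge (Gamma x)} ->
  (path_lip m Gamma <= L%:E)%E -> (path_norm m Gamma <= M%:E)%E ->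
  path_bound m Gamma L M.
Proof.
move=> nn /ess_supP lip /ess_supP norm; split.
  move: nn norm; apply: (@filterS2 _ _ (ae_filter_ringOfSetsType m)) => x nx Mx.
  split => //; rewrite -lee_fin fineK ?fin_num_measure//.
  exact: le_trans (mass_le_Wnorm nx) Mx.
move: lip; apply: (@filterS _ _ (ae_filter_ringOfSetsType (m \x m)%E)).
move=> [x y] /= xyL h tf; have [->|xy] := eqVneq x y.
  by rewrite subrr normr0 mdistxx mulr0.
have d0 : 0 < mdist x y by rewrite mdist_gt0.
have := cint_le_Wnorm (cadd (Gamma x) (copp (Gamma y))) tf.
rewrite cint_sub; last exact: test_fun_bounded.
move=> hW; rewrite -ler_pdivrMr// -lee_fin; apply: le_trans xyL.
by rewrite EFinM lee_pmul2r// lte_fin invr_gt0.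
Qed.

Lemma path_lip_le Gamma (L M : R) : 0 <= L ->
  path_bound m Gamma L M -> (path_lip m Gamma <= L%:E)%E.
Proof.
move=> L0 [_ lip]; apply/ess_supP; move: lip.
apply: (@filterS _ _ (ae_filter_ringOfSetsType (m \x m)%E)).
move=> [x y] /= xyL; have [->|xy] := eqVneq x y.
  by rewrite mdistxx invr0 mule0 lee_fin.
have d0 : 0 < mdist x y by rewrite mdist_gt0.
rewrite lee_pdivrMr// -EFinM; apply: Wnorm_le => h tf.
by rewrite lee_fin cint_sub; [exact: xyL|exact: test_fun_bounded].
Qed.

Lemma lip_const_ge0 (f : X -> R) : (0 <= lip_const f)%E.
Proof.
apply: ereal_sup_ge; exists 0%E => //.
by exists (point, point) => //=; rewrite subrr normr0 mul0r.
Qed.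

Lemma lip_const_lipschitz (f : X -> R) (l : R) : lip_const f = l%:E ->
  forall x y, `|f x - f y| <= l * mdist x y.
Proof.
move=> fl x y; have [->|xy] := eqVneq x y.
  by rewrite subrr normr0 mdistxx mulr0.
rewrite -ler_pdivrMr ?mdist_gt0// -lee_fin -fl.
by apply: ereal_sup_ubound; exists (x, y).
Qed.

(** The density integrates to the value of a measure on the set where it is
    negative, so this set is null. *)
Lemma representation_nonneg
    (mu : {finite_measure set (X * Y)%type -> \bar R})
    (omega : disintegration m mu) :
  {ae m, forall x : X, nonneg_charge (representation omega x)}.
Proof.
have md := density_measurable omega.
pose B : set X := [set x | density omega x < 0].
have mB : measurable B.
  rewrite (_ : B = density omega @^-1` `]-oo, 0[%classic).
    by rewrite -[X in measurable X]setTI; exact: md.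
  by apply/seteqP; split => x; rewrite /= in_itv.
have mE : measurable_fun B (EFin \o density omega).
  exact/measurable_funTS/measurable_EFinP.
have : ae_eq m B (EFin \o density omega) (cst 0%E).
  apply/(ae_eq_integral_abs _ mB mE).1; apply/eqP.
  rewrite eq_le integral_ge0 ?andbT//.
  rewrite -leeN2 oppe0 -integral_ge0N//.
  rewrite (eq_integral (EFin \o density omega)); last first.
    by move=> x /[!inE] xB; rewrite /= ltr0_norm// opprK.
  by rewrite -(densityE omega mB) /pushforward measure_ge0.
apply: (@filterS _ _ (ae_filter_ringOfSetsType m)) => x Bx E.
apply: mule_ge0; last exact: measure_ge0.
rewrite lee_fin leNgt; apply/negP => dx.
by have := Bx dx => -[dx0]; move: dx; rewrite dx0 ltxx.
Qed.

End path_constants.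

Theorem theorem7p7 (R : realType) (N : nat) (A : aperiodic_matrix N)
    (theta : {itv R & `]0, 1[})
    (m : probability (borel (shift_space A theta)) R)
    (hm : is_markov_measure m)
    (J : borel (shift_space A theta) -> R) (hJ : is_jacobian m J)
    (K : pmetricType R) (hK : compact [set: K])
    (hdiam : ereal_sup [set (mdist p.1 p.2)%:E | p in [set: K * K]] = 1%:E)
    (G : {mfun (borel (shift_space A theta) * borel K)%type >-> borel K})
    (alpha : R) (halpha0 : 0 < alpha) (halpha1 : alpha < 1)
    (hcontr : {ae m, forall x, forall y1 y2 : borel K,
      mdist (G (x, y1)) (G (x, y2)) <= alpha * mdist y1 y2})
    (k : borel K -> R) (hk0 : forall y, 0 <= k y)
    (hklip : forall (y : borel K) (x1 x2 : borel (shift_space A theta)),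
      mdist (G (x1, y)) (G (x2, y)) <= k y * mdist x1 x2)
    (hkbound : has_ubound (range k))
    (mu : {finite_measure set
      (borel (shift_space A theta) * borel K)%type -> \bar R})
    (hmu : in_L_theta_plus m mu)
    (omega : disintegration m mu)
    (n : nat) (hn : (1 <= n)%N) :
  let g := fun x => (J x)^-1 in
  let H := sup (range k) in
  let C1 := Order.max
    ((H * theta%:num)%:E + (theta%:num * N%:R)%:E * lip_const g)%E 2%:E in
  (path_lip m (iter n (transfer G g) (representation omega)) <=
    (theta%:num ^+ n)%:E * path_lip m (representation omega) +
    C1 * ((1 - theta%:num)^-1)%:E * path_norm m (representation omega))%E.
Proof.
lazy zeta; set g := fun x => (J x)^-1; set H := sup (range k).
set C1 := Order.max _ _.
have t0 := @theta_ge0 R theta; have t1 := @onem_theta_gt0 R theta.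
have k_le y : k y <= H by apply: sup_upper_bound => //; split => //; exists (k point), point.
have H0 : 0 <= H by exact: le_trans (hk0 point) (k_le point).
have contr : {ae m, forall x, forall y1 y2 : borel K,
    mdist (G (x, y1)) (G (x, y2)) <= mdist y1 y2}.
  move: hcontr; apply: (@filterS _ _ (ae_filter_ringOfSetsType m)) => x c y1 y2.
  by apply: le_trans (c y1 y2) _; rewrite ler_piMl ?mdist_ge0// ltW.
have flip (y : borel K) (x1 x2 : borel (shift_space A theta)) :
    mdist (G (x1, y)) (G (x2, y)) <= H * mdist x1 x2.
  by apply: le_trans (hklip y x1 x2) _; rewrite ler_wpM2r// mdist_ge0.
have nn := representation_nonneg omega.
have := path_bound_of_norms nn.
have := path_lip_ge0 m (representation omega).
have := path_norm_ge0 m (representation omega).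
have C1_ge2 : (2%:E <= C1)%E by rewrite /C1 le_max lexx orbT.
have C1_gt0 : (0 < C1)%E by exact: lt_le_trans C1_ge2.
have c_gt0 : (0 < (1 - theta%:num)^-1%:E :> \bar R)%E by rewrite lte_fin invr_gt0.
have tn0 : 0 < theta%:num ^+ n :> R by rewrite exprn_gt0//; exact: theta_gt0.
move: (path_lip m (representation omega)) (path_norm m (representation omega)).
move=> [L| |] [M| |]// M0 L0 bound; first last.
- by rewrite gt0_muley ?lte_fin// gt0_muley ?mule_gt0// leey.
- by rewrite gt0_muley ?lte_fin// addye ?leey// gt_eqF// (lt_le_trans ltNy0)//
    mule_ge0// ltW// mule_gt0.
- by rewrite gt0_muley ?mule_gt0// addey ?leey.
(* Only the finite case remains: an infinite constant makes the right-hand side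
   infinite. *)
have pb := bound L M (lexx _) (lexx _); rewrite !lee_fin in M0 L0.
have main D C : 0 <= D ->
    (forall x y, `|g x - g y| * M <= D * mdist x y) ->
    2 * M <= C -> H * theta%:num * M + theta%:num * N%:R * D <= C ->
    (path_lip m (iter n (transfer G g) (representation omega)) <=
     (theta%:num ^+ n * L + C * (1 - theta%:num)^-1)%:E)%E.
  move=> D0 gD MC HC; have C0 : 0 <= C by apply: le_trans MC; rewrite mulr_ge0.
  have bn := iter_transfer_bound hm hJ contr H0 flip n L0 M0 D0 gD MC HC pb.
  apply: le_trans (path_lip_le _ bn) _.
    by apply: addr_ge0; apply: mulr_ge0 => //; exact: ltW.
  by rewrite lee_fin lerD2l ler_wpM2l// -[leRHS]mul1r ler_pM2r ?invr_gt0.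
have N_gt0 : 0 < theta%:num * N%:R :> R.
  by rewrite mulr_gt0 ?ltr0n ?(adj_dim A)//; exact: theta_gt0.
have := lip_const_ge0 g; case gl : (lip_const g) => [l| |] // l0.
  rewrite /C1 gl in C1_ge2 C1_gt0 *; rewrite lee_fin in l0.
  have := main (l * M) (Order.max (H * theta%:num + theta%:num * N%:R * l) 2 * M).
  move=> /(_ (mulr_ge0 l0 M0)) le_main; apply: le_trans (le_main _ _ _) _.
  - by move=> x y; rewrite mulrAC ler_wpM2r//; exact: lip_const_lipschitz.
  - by rewrite ler_wpM2r// le_max lexx orbT.
  - rewrite (_ : _ + _ = (H * theta%:num + theta%:num * N%:R * l) * M); last ring.
    by rewrite ler_wpM2r// le_max lexx.
  rewrite -EFinM -EFinD -EFin_max -!EFinM -EFinD lee_fin lerD2l.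
  by rewrite mulrAC.
have C1y : C1 = +oo%E by rewrite /C1 gl gt0_muley ?lte_fin// addey.
rewrite C1y gt0_mulye//; move: M0; rewrite le_eqVlt => /predU1P[M0|M0].
  (* [C1] is infinite but the norm is 0, and [+oo * 0 = 0]: as [Gamma] vanishes
     almost everywhere, the iterated bound applies with [D = C = 0]. *)
  have le_main := main 0 0 (lexx 0); rewrite -M0 mule0 adde0.
  apply: le_trans (le_main _ _ _) _; rewrite -?M0 ?mulr0 ?addr0//.
    by move=> x y; rewrite mulr0 mul0r.
  by rewrite mul0r addr0.
by rewrite gt0_mulye ?lte_fin// addey ?leey.
Qed.
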